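(* Let $\alpha > -1$ be fixed. Then $C_\alpha(p) \approx p$ for $p \geq 1$; that is, there exist constants $A, B > 0$ (depending only on $\alpha$) such that \[ A\, p \leq C_\alpha (p) \leq B\, p, \quad \forall p \geq 1. \]
   Context: $\mathbb{D}$ is the open unit disk of $\mathbb{C}$ and $dA(z) = \frac{1}{\pi}\,dx\,dy$. For $\alpha>-1$, $d\mu_\alpha(z) := (\alpha+1)(1-|z|^2)^\alpha\,dA(z)$, and for $p>0$ and $f$ analytic in $\mathbb{D}$, $\|f\|_{A^p_\alpha} := \left(\int_{\mathbb{D}} |f|^p\,d\mu_\alpha\right)^{1/p}$. The Bloch space $\mathcal{B}$ is the set of analytic $f$ in $\mathbb{D}$ with $\rho_{\mathcal{B}}(f) := \sup_{z\in\mathbb{D}} |f'(z)|(1-|z|^2)<\infty$, normed by $\|f\|_{\mathcal{B}} := |f(0)| + \rho_{\mathcal{B}}(f)$. For $\alpha>-1$ and $p>0$, \[ C_\alpha(p) := \max\{\|f\|_{A^p_\alpha} : f\in\mathcal{B},\ \|f\|_{\mathcal{B}}\leq 1\} \] (the supremum is finite and attained). *)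

(* Defs.v *)
From HB Require Import structures.
From mathcomp Require Import all_boot all_order all_algebra.
From mathcomp Require Import all_classical all_reals all_analysis.
From mathcomp Require Import complex.

Set Implicit Arguments.
Unset Strict Implicit.
Unset Printing Implicit Defensive.

Import Order.TTheory GRing.Theory Num.Theory.
Import numFieldNormedType.Exports.

Local Open Scope classical_set_scope.
Local Open Scope ring_scope.
Local Open Scope complex_scope.

(* The library norm on R[i] takes its values in R[i]; [Normc.normc] is the
   R-valued modulus: `|z| = (Normc.normc z)%:C. *)
Notation cmod := Normc.normc.

Definition unit_disk (R : realType) : set R[i] := [set z | cmod z < 1].

(* R[i]^o is R[i] as a normed module over itself, so [derivable f z 1] and
   [derive1 f z] are the complex differentiability and derivative at z.  The
   functions are total; their values off the disk are never used. *)
Definition analytic_in_disk (R : realType) (f : R[i] -> R[i]^o) : Prop :=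
  forall z : R[i], unit_disk z -> derivable (f : R[i]^o -> R[i]^o) z 1.

Definition bloch_seminorm (R : realType) (f : R[i] -> R[i]^o) : \bar R :=
  ereal_sup [set (cmod (derive1 f z) * (1 - cmod z ^+ 2))%:E | z in @unit_disk R].

Definition bloch_norm (R : realType) (f : R[i] -> R[i]^o) : \bar R :=
  ((cmod (f 0))%:E + bloch_seminorm f)%E.

Definition bloch_space (R : realType) : set (R[i] -> R[i]^o) :=
  [set f | analytic_in_disk f /\ (bloch_seminorm f < +oo)%E].

(* density of d mu_alpha with respect to dx dy; the factor 1 / pi is the
   normalisation of dA *)
Definition bergman_weight (R : realType) (alpha : R) (z : R[i]) : R :=
  (alpha + 1) * (1 - cmod z ^+ 2) `^ alpha * pi^-1.

(* the point (x, y) of R * R stands for x + i y *)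
Definition bergman_norm (R : realType) (alpha p : R) (f : R[i] -> R[i]^o)
    : \bar R :=
  ((\int[lebesgue_measure \x lebesgue_measure]_(w in
        [set w : R * R | unit_disk (w.1 +i* w.2)])
      (cmod (f (w.1 +i* w.2)) `^ p * bergman_weight alpha (w.1 +i* w.2))%:E)
   `^ p^-1)%E.

Definition bloch_bergman_const (R : realType) (alpha p : R) : \bar R :=
  ereal_sup [set bergman_norm alpha p f | f in
    [set f | bloch_space f /\ (bloch_norm f <= 1)%E]].

(* Main.v *)
(** Upper bound: integrating |f'(w)| <= 1 / (1 - |w|) along the radius gives
    |f(z)| <= 1 - ln (1 - |z|).  Applying x <= exp x to (c/p) |f(z)| bounds
    |f(z)|^p by (p/c)^p times a constant times (1 - |z|^2)^(-c), and for
    0 < c < alpha + 1 the weight (1 - |z|^2)^(alpha - c) is integrable on the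
    disk; the p-th root is O(p).

    Lower bound: the lacunary polynomial (1/4) sum_(k < m) z^(2^k) has Bloch norm
    at most 1 for every m, and modulus at least m / 8 when |z - 1| <= (3/4) 2^-m.
    With m of order p, a square of side 2^-(m+2) in that region has
    mu_alpha-measure at least exp(-C p), which only costs a constant factor after
    the p-th root. *)

Require Import Defs.
From mathcomp Require Import all_boot all_order all_algebra.
From mathcomp Require Import all_classical all_reals all_analysis.
From mathcomp Require Import complex measurable_realfun ring lra.

Set Implicit Arguments.
Unset Strict Implicit.
Unset Printing Implicit Defensive.

Import Order.TTheory GRing.Theory Num.Theory.
Import numFieldNormedType.Exports.

Local Open Scope classical_set_scope.
Local Open Scope ring_scope.
Local Open Scope complex_scope.

(** * Integrals of powers over an interval and over the disk *)

(* Holds without measurability: the integral of a nonnegative function is the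
   supremum of the integrals of the simple functions below it. *)
Lemma le_integral_patch d (T : measurableType d) (R : realType)
    (mu : {measure set T -> \bar R}) (D E : set T) (f g : T -> \bar R) :
  (forall x, D x -> (0 <= f x)%E) -> (forall x, E x -> (0 <= g x)%E) ->
  (forall x, D x -> (f x <= (g \_ E) x)%E) ->
  (\int[mu]_(x in D) f x <= \int[mu]_(x in E) g x)%E.
Proof.
move=> f0 g0 fg; rewrite !ge0_integralE//.
apply: le_ereal_sup => _ [h /= hf <-]; exists h => // x.
apply: (le_trans (hf x)); rewrite [leLHS]patchE.
case: ifPn => [/set_mem Dx|_]; first exact: fg.
by rewrite patchE; case: ifPn => // /set_mem Ex; exact: g0.
Qed.

(** The integrand may blow up at both endpoints, as negative powers do below. The fundamental
    theorem is applied on compact intervals exhausting []a, b[], where the bounds on [F] stand in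
    for endpoint values, and monotone convergence carries the estimate to the limit. *)
Lemma integral_derive1_itvoo_le (R : realType) (f F : R -> R) (a b m M : R) :
  a < b -> {in `]a, b[, continuous f} ->
  {in `]a, b[, forall x : R, is_derive x 1 F (f x)} ->
  {in `]a, b[, forall x : R, 0 <= f x} ->
  {in `]a, b[, forall x : R, m <= F x <= M} ->
  (\int[lebesgue_measure]_(x in `]a, b[) (f x)%:E <= (M - m)%:E)%E.
Proof.
move=> ab cf dF f0 mFM.
(* The factor 1/3 keeps [a + e n < b - e n] already at [n = 0]. *)
pose e (n : nat) : R := (b - a) / 3 * n.+1%:R^-1.
have e0 n : 0 < e n by rewrite /e mulr_gt0// ?invr_gt0// divr_gt0// subr_gt0.
have eb n : e n <= (b - a) / 3.
  rewrite /e ger_pMr ?invf_le1 ?ler1n//; lra.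
pose I n : set R := `[a + e n, b - e n]%classic.
have IJ n x : x \in `[a + e n, b - e n] -> x \in `]a, b[.
  by rewrite !in_itv/=; have := e0 n; lra.
have cupI : \bigcup_n I n = `]a, b[%classic.
  apply/seteqP; split=> x /=; first by move=> [n _ /IJ].
  rewrite in_itv/= => /andP[ax xb].
  have d0 : 0 < Num.min (x - a) (b - x) by rewrite lt_min !subr_gt0 ax xb.
  have c0 : 0 < (b - a) / 3 by rewrite divr_gt0// subr_gt0.
  have /ltr_add_invr[n] := divr_gt0 d0 c0.
  rewrite add0r ltr_pdivlMr// mulrC -/(e n) lt_min => /andP[h1 h2].
  by exists n => //; rewrite /I/= in_itv/=; apply/andP; split; lra.
have cfI n : {within I n, continuous f}.
  apply: continuous_in_subspaceT => x; rewrite inE => xI.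
  by apply: cf; exact: IJ xI.
rewrite -cupI.
have cv := @ge0_nondecreasing_set_cvg_integral _ (measurableTypeR R) R I
  (EFin \o f) lebesgue_measure.
apply: (cvge_to_le (cv _ _ _ _)) => /=.
- apply/nondecreasing_seqP => n; rewrite subsetEset /I => x /=.
  rewrite !in_itv/= => /andP[h1 h2].
  suff : e n.+1 <= e n by lra.
  by rewrite /e ler_pM2l ?lef_pV2 ?posrE// ?ler_nat// divr_gt0// subr_gt0.
- by move=> n; exact: measurable_itv.
- move=> n; apply/measurable_EFinP.
  by apply: subspace_continuous_measurable_fun => //; exact: measurable_itv.
- by move=> n x xI /=; rewrite lee_fin f0//; exact: IJ xI.
- apply: nearW => n; have abn : a + e n < b - e n by have := eb n; lra.
  have inab x : x \in `[a + e n, b - e n] -> derivable F x 1 /\ {for x, continuous F}.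
    move=> /IJ /dF dx; split; first by case: dx.
    by apply: differentiable_continuous; apply/derivable1_diffP; case: dx.
  rewrite (@continuous_FTC2 _ f F)//; last 3 first.
  + exact: cfI.
  + split.
    * by move=> x /subset_itv_oo_cc /inab[].
    * apply: cvg_at_right_filter; apply: (inab _ _).2.
      by rewrite in_itv/= lexx ltW.
    * apply: cvg_at_left_filter; apply: (inab _ _).2.
      by rewrite in_itv/= lexx ltW.
  + move=> x /subset_itv_oo_cc /IJ xab; rewrite derive1E.
    by have [_] := dF _ xab.
  + rewrite -EFinB lee_fin.
    have /IJ/mFM : b - e n \in `[a + e n, b - e n] by rewrite in_itv/= lexx ltW.
    have /IJ/mFM : a + e n \in `[a + e n, b - e n] by rewrite in_itv/= lexx ltW.
    lra.
Qed.

Lemma is_derive_powR_comp (R : realType) (g : R -> R) (b x dg : R) : 0 < g x ->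
  is_derive x 1 g dg -> is_derive x 1 (fun y => g y `^ b) (b * g x `^ (b - 1) * dg).
Proof.
move=> gx0 dgx.
exact: (is_derive1_comp (f := fun t => t `^ b) (is_derive1_powR b gx0) dgx).
Qed.

Lemma integral_powR_sum_le (R : realType) (b c s : R) :
  -1 < b -> 0 <= c -> 0 < s ->
  (\int[lebesgue_measure]_(y in `](- s)%R, s[)
     (c * ((s - y) `^ b + (s + y) `^ b))%:E <=
   (c * (2 * (2 * s) `^ (b + 1) / (b + 1)))%:E)%E.
Proof.
move=> b1 c0 s0; have b10 : 0 < b + 1 by lra.
under eq_integral do rewrite EFinM.
rewrite ge0_integralZl_EFin//; last 2 first.
- by move=> x _; rewrite lee_fin addr_ge0// powR_ge0.
- apply/measurable_EFinP; apply: measurable_funD.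
    apply: (measurableT_comp (measurable_powR b)); exact: measurable_funB.
  apply: (measurableT_comp (measurable_powR b)); exact: measurable_funD.
rewrite EFinM; apply: lee_wpmul2l; first by rewrite lee_fin.
pose F (y : R) := (b + 1)^-1 * ((s + y) `^ (b + 1) - (s - y) `^ (b + 1)).
have E : 2 * (2 * s) `^ (b + 1) / (b + 1) =
    (2 * s) `^ (b + 1) / (b + 1) - (- ((2 * s) `^ (b + 1) / (b + 1))) by field; lra.
have d1 (a x : R) : 0 < s - x ->
    is_derive x 1 (fun y : R => (s - y) `^ a) (a * (s - x) `^ (a - 1) * (- 1)).
  move=> sx; apply: is_derive_powR_comp => //.
  by apply: is_derive_eq; rewrite add0r mul1r.
have d2 (a x : R) : 0 < s + x ->
    is_derive x 1 (fun y : R => (s + y) `^ a) (a * (s + x) `^ (a - 1) * 1).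
  move=> sx; apply: is_derive_powR_comp => //.
  by apply: is_derive_eq; exact: add0r.
rewrite E; apply: (@integral_derive1_itvoo_le R _ F).
- lra.
- move=> x; rewrite in_itv/= => /andP[h1 h2].
  apply: differentiable_continuous; apply/derivable1_diffP.
  apply: derivableD; apply: ex_derive.
    by apply: d1; lra.
  by apply: d2; lra.
- move=> x; rewrite in_itv/= => /andP[h1 h2].
  have sx : 0 < s - x by lra.
  have xs : 0 < s + x by lra.
  have := d1 (b + 1) x sx; have := d2 (b + 1) x xs => ? ?.
  apply: is_derive_eq; rewrite /GRing.scale/= addrK; field; lra.
- by move=> x _; rewrite addr_ge0// powR_ge0.
- move=> x; rewrite in_itv/= => /andP[h1 h2].
  have : (s + x) `^ (b + 1) <= (2 * s) `^ (b + 1).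
    by apply: ge0_ler_powR; rewrite ?nnegrE; lra.
  have : (s - x) `^ (b + 1) <= (2 * s) `^ (b + 1).
    by apply: ge0_ler_powR; rewrite ?nnegrE; lra.
  have := powR_ge0 (s - x) (b + 1); have := powR_ge0 (s + x) (b + 1).
  move=> p1 p2 q1 q2; have iv : 0 < (b + 1)^-1 by rewrite invr_gt0.
  by rewrite /F ![_ / (b + 1)]mulrC -mulrN !(ler_pM2l iv); lra.
Qed.

Lemma le0_ger_powR (R : realType) (r x y : R) :
  r <= 0 -> 0 < x -> x <= y -> y `^ r <= x `^ r.
Proof.
move=> r0 x0 xy; have y0 : 0 < y by lra.
by rewrite /powR !gt_eqF// ler_expR ler_wnM2l// ler_ln.
Qed.

(* The larger of [u] and [v] is at least their mean [t]. *)
Lemma powRM_le_mean (R : realType) (b t u v : R) : b <= 0 -> 0 < u -> 0 < v ->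
  u + v = 2 * t -> (u * v) `^ b <= t `^ b * (u `^ b + v `^ b).
Proof.
move=> b0 u0 v0 uvt.
have t0 : 0 < t by lra.
rewrite (powRM _ (ltW u0) (ltW v0)).
have [ut|tu] := leP t u.
  rewrite mulrDr; apply: ler_wpDl; first by rewrite mulr_ge0 ?powR_ge0.
  by rewrite ler_wpM2r ?powR_ge0// le0_ger_powR.
have tv : t <= v by lra.
rewrite mulrC mulrDr; apply: ler_wpDr; first by rewrite mulr_ge0 ?powR_ge0.
by rewrite ler_wpM2r ?powR_ge0// le0_ger_powR.
Qed.

(** By Tonelli, slice at fixed x and set s = sqrt (1 - x^2), so that 1 - x^2 - y^2 = (s - y)(s + y).
    [powRM_le_mean] replaces the power of this product by a sum of powers, which integrates to at
    most C s^(2b+1) = C ((1 - x)(1 + x))^g with g = b + 1/2. The bound b <= -1/2 gives g <= 0, so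
    the same splitting works in x, and b > -1 gives g > -1. *)
Lemma integral_disk_powR (R : realType) (b : R) : -1 < b -> b <= - 2^-1 ->
  exists2 K : R, 0 < K & forall a : R, 0 <= a ->
    (\int[lebesgue_measure \x lebesgue_measure]_(w in
        [set w : R * R | w.1 ^+ 2 + w.2 ^+ 2 < 1]%R)
      (a * (1 - (w.1 ^+ 2 + w.2 ^+ 2)) `^ b)%:E <= (a * K)%:E)%E.
Proof.
move=> b1 b2; set D := [set w : R * R | _].
pose f (w : R * R) : \bar R := ((1 - (w.1 ^+ 2 + w.2 ^+ 2)) `^ b)%:E.
pose C := 2 * 2 `^ (b + 1) / (b + 1).
have C0 : 0 < C by rewrite divr_gt0 ?mulr_gt0 ?powR_gt0//; lra.
pose g := b + 2^-1.
exists (C * (2 * (2 * 1) `^ (g + 1) / (g + 1))).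
  by rewrite mulr_gt0// divr_gt0 ?mulr_gt0 ?powR_gt0// /g; lra.
have mN : measurable_fun setT (fun w : R * R => 1 - (w.1 ^+ 2 + w.2 ^+ 2)).
  by apply: measurable_funB => //; apply: measurable_funD; apply: measurable_funX.
have mD : measurable D.
  rewrite (_ : D = (fun w : R * R => 1 - (w.1 ^+ 2 + w.2 ^+ 2)) @^-1` `]0, +oo[%classic).
    by rewrite -[X in measurable X]setTI; apply: mN => //; exact: measurable_itv.
  by apply/seteqP; split=> w; rewrite /D/= in_itv/= andbT subr_gt0.
have mf' : measurable_fun setT f.
  apply/measurable_EFinP; exact: measurableT_comp (measurable_powR b) mN.
have mf : measurable_fun setT (f \_ D).
  apply/measurable_restrict => //; rewrite setTI.
  exact: measurable_funTS.
have f0 w : (0 <= (f \_ D) w)%E.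
  by apply: erestrict_ge0 => ? _; rewrite lee_fin powR_ge0.
move=> a a0; under eq_integral do rewrite EFinM.
rewrite ge0_integralZl_EFin//; last 2 first.
- by move=> w _; rewrite lee_fin powR_ge0.
- exact: measurable_funTS.
rewrite EFinM; apply: lee_wpmul2l; first by rewrite lee_fin.
rewrite -/f integral_mkcond fubini_tonelli1//.
apply: (le_trans _ (integral_powR_sum_le _ (ltW C0) ltr01)); last by rewrite /g; lra.
apply: le_integral_patch.
- by move=> x _; rewrite /fubini_F; apply: integral_ge0 => y _.
- by move=> x _; rewrite lee_fin mulr_ge0 ?(ltW C0)// addr_ge0 ?powR_ge0.
(* Slices outside []-1, 1[] miss the disk and contribute 0. *)
move=> x _; rewrite patchE; case: ifPn => [|xI]; last first.
  rewrite /fubini_F integral0_eq// => y _; rewrite patchE ifF//.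
  apply/negbTE; apply: contra xI; rewrite !inE /D/= in_itv/= => xy1.
  have := sqr_ge0 y; move: xy1; nra.
rewrite inE/= in_itv/= => /andP[x1 x2].
have s2 : 0 < 1 - x ^+ 2 by nra.
set s := Num.sqrt (1 - x ^+ 2).
have s0 : 0 < s by rewrite sqrtr_gt0.
have sE : s ^+ 2 = 1 - x ^+ 2 by rewrite sqr_sqrtr// ltW.
apply: (@le_trans _ _ (\int[lebesgue_measure]_(y in `](- s)%R, s[)
   (s `^ b * ((s - y) `^ b + (s + y) `^ b))%:E)%E).
  apply: le_integral_patch => [//|y _|y _].
    by rewrite lee_fin mulr_ge0 ?addr_ge0 ?powR_ge0.
  rewrite [leLHS]patchE; case: ifPn => [|_]; last first.
    by apply: erestrict_ge0 => z _; rewrite lee_fin mulr_ge0 ?addr_ge0 ?powR_ge0.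
  rewrite inE /D/= => xy1.
  have [sy1 sy2] : -s < y /\ y < s by split; nra.
  rewrite patchE mem_set/= ?in_itv/= ?sy1 ?sy2// lee_fin.
  have -> : 1 - (x ^+ 2 + y ^+ 2) = (s - y) * (s + y) by rewrite -subr_sqr sE; ring.
  by apply: powRM_le_mean; lra.
apply: (le_trans (integral_powR_sum_le _ (powR_ge0 _ _) s0)) => //.
rewrite lee_fin.
have -> : s `^ b * (2 * (2 * s) `^ (b + 1) / (b + 1)) = C * ((1 - x) * (1 + x)) `^ g.
  have -> : (1 - x) * (1 + x) = s ^+ 2 by rewrite sE -subr_sqr expr1n.
  rewrite (powRM _ (ler0n _ 2) (ltW s0)) -(powR_mulrn 2 (ltW s0)) -powRrM.
  have -> : 2%:R * g = b + (b + 1) by rewrite /g; field.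
  rewrite [in RHS]powRD ?(gt_eqF s0) ?implybT// /C; field; lra.
rewrite ler_pM2l//.
have g0 : g <= 0 by rewrite /g; lra.
have x10 : 0 < 1 - x by lra.
have x20 : 0 < 1 + x by lra.
have := @powRM_le_mean _ g 1 _ _ g0 x10 x20; rewrite powR1 !mul1r; apply.
by ring.
Qed.

(** * The real-valued modulus on the complex numbers *)

Section Modulus.
Variable R : realType.
Implicit Types z w : R[i].

Lemma cmod_ge0 z : 0 <= cmod z.
Proof. by case: z => a b; exact: sqrtr_ge0. Qed.

Lemma cmodN z : cmod (- z) = cmod z.
Proof. exact: normcN. Qed.

Lemma cmodD z w : cmod (z + w) <= cmod z + cmod w.
Proof. exact: le_normcD. Qed.

Lemma cmodX z n : cmod (z ^+ n) = cmod z ^+ n.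
Proof.
elim: n => [|n IH]; first by rewrite !expr0 Normc.normc1.
by rewrite !exprS Normc.normcM IH.
Qed.

Lemma sqr_cmod (a b : R) : cmod (a +i* b) ^+ 2 = a ^+ 2 + b ^+ 2.
Proof. by rewrite sqr_sqrtr// addr_ge0 ?sqr_ge0. Qed.

Lemma cmod_real (a : R) : cmod a%:C = `|a|.
Proof. by rewrite /Normc.normc/= expr0n/= addr0 sqrtr_sqr. Qed.

Lemma cmod_nat n : cmod (n%:R : R[i]) = n%:R.
Proof. by rewrite -(rmorph_nat (real_complex R)) cmod_real normr_nat. Qed.

Lemma ler_Re_cmod z : `|complex.Re z| <= cmod z.
Proof.
by case: z => a b /=; rewrite -sqrtr_sqr ler_wsqrtr// lerDl sqr_ge0.
Qed.

Lemma cmod_conjc z : cmod z^*%C = cmod z.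
Proof. by case: z => a b /=; rewrite sqrrN. Qed.

Lemma cmod_gt0 z : (0 < cmod z) = (z != 0).
Proof.
rewrite lt_def cmod_ge0 andbT; apply/idP/idP.
  by apply: contra => /eqP ->; rewrite Normc.normc0.
by apply: contra => /eqP/Normc.eq0_normc ->.
Qed.

Lemma Re_conjcM z : complex.Re (z^*%C * z) = cmod z ^+ 2.
Proof. by case: z => a b; rewrite sqr_cmod /=; ring. Qed.

End Modulus.

(** * Derivatives along a radius and growth of Bloch functions *)

(** First-order expansions with explicit epsilon link complex differentiability to real
    differentiability; this is the direction from expansion to derivative. *)
Lemma is_derive1_eps (R : realType) (F : R -> R) (t l : R) :
  (forall e : R, 0 < e -> exists2 d : R, 0 < d &
     forall k, `|k| < d -> `|F (t + k) - F t - l * k| <= e * `|k|) ->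
  is_derive t 1 F l.
Proof.
move=> H.
have cv : h^-1 *: (F (h *: 1 + t) - F t) @[h --> 0^'] --> l.
  apply/cvgrPdist_le => e e0; have [d d0 Hd] := H e e0.
  near=> h.
  have h0 : h != 0 by near: h; exact: nbhs_dnbhs_neq.
  have hd : `|h| < d by near: h; apply: dnbhs0_lt.
  have := Hd h hd; rewrite -ler_pdivrMr ?normr_gt0// -normf_div.
  rewrite distrC; apply: le_trans; rewrite le_eqVlt; apply/orP; left; apply/eqP.
  congr (`| _ |); rewrite /GRing.scale/= mulr1 [h + t]addrC; field; exact: h0.
apply: DeriveDef; first exact: cvgP cv.
exact: cvg_lim cv.
Unshelve. all: by end_near. Qed.

(** The norm of [R[i]] is itself [R[i]]-valued, so the library supplies a complex radius; being
    positive it has zero imaginary part, and its real part serves as [d]. *)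
Lemma complex_derive1_eps (R : realType) (f : R[i] -> R[i]^o) (z : R[i]) :
  derivable (f : R[i]^o -> R[i]^o) z 1 ->
  forall e : R, 0 < e -> exists2 d : R, 0 < d &
    forall k : R[i], cmod k < d ->
      cmod (f (z + k) - f z - derive1 f z * k) <= e * cmod k.
Proof.
move=> df e e0.
have eC : 0 < e%:C by rewrite ltcR.
have /cvgrPdist_le/(_ _ eC)[d /= d0 Hd] := df.
rewrite derive1E.
move: d0; rewrite ltcE/= => /andP[/eqP dI d0].
exists (complex.Re d) => // k kd.
have [->|k0] := eqVneq k 0.
  by rewrite addr0 mulr0 subrr subr0 Normc.normc0 mulr0.
have cke : cmod k != 0 by apply: contra k0 => /eqP/Normc.eq0_normc ->.
pose a : R[i] := 'D_1 (f : R[i]^o -> R[i]^o) z.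
rewrite -/a.
have : `|a - k^-1 * (f (k * 1 + z) - f z)| <= e%:C.
  by apply: Hd k0; rewrite /= sub0r normrN ltcE/= dI eqxx.
rewrite lecR mulr1 => H.
have -> : f (z + k) - f z - a * k = - k * (a - k^-1 * (f (k + z) - f z)).
  rewrite [k + z]addrC mulrBr !mulNr mulVKf//; ring.
by rewrite Normc.normcM cmodN mulrC ler_wpM2r// cmod_ge0.
Qed.

(** The real part of [c] times the complex expansion of [f] with increment [k%:C * z] is the
    required real expansion, with remainder at most [cmod c] times the complex one. *)
Lemma is_derive_Re_radial (R : realType) (f : R[i] -> R[i]^o) (c z : R[i]) (t : R) :
  derivable (f : R[i]^o -> R[i]^o) (t%:C * z) 1 ->
  is_derive t 1 (fun s : R => complex.Re (c * f (s%:C * z)))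
    (complex.Re (c * (derive1 f (t%:C * z) * z))).
Proof.
move=> df; apply: is_derive1_eps => e e0.
(* Adding 1 keeps both denominators positive when [c] or [z] vanishes. *)
pose m := cmod c * cmod z + 1; pose n := cmod z + 1.
have m0 : 0 < m by rewrite ltr_wpDl// mulr_ge0 ?cmod_ge0.
have n0 : 0 < n by rewrite ltr_wpDl// cmod_ge0.
have [d d0 Hd] := complex_derive1_eps df (divr_gt0 e0 m0).
exists (d / n); first by rewrite divr_gt0.
move=> k kd.
have kz : cmod (k%:C * z) = `|k| * cmod z by rewrite Normc.normcM cmod_real.
have /Hd : cmod (k%:C * z) < d.
  rewrite kz (@le_lt_trans _ _ (`|k| * n))//; last by rewrite -ltr_pdivlMr.
  by rewrite ler_wpM2l// /n lerDl.
set u := (X in cmod X <= _) => Hu.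
have -> : complex.Re (c * f ((t + k)%:C * z)) - complex.Re (c * f (t%:C * z)) -
    complex.Re (c * (derive1 f (t%:C * z) * z)) * k = complex.Re (c * u).
  rewrite /u rmorphD/= mulrDl.
  move: (f _) (f _) (derive1 f _) => [a1 a2] [b1 b2] [c1 c2].
  by case: (c) => ? ?; case: (z) => ? ? /=; ring.
apply: (le_trans (ler_Re_cmod _)); rewrite Normc.normcM.
apply: (le_trans (ler_wpM2l (cmod_ge0 _) Hu)).
rewrite kz.
have -> : cmod c * (e / m * (`|k| * cmod z)) = (e * `|k|) * ((cmod c * cmod z) / m).
  by field; rewrite gt_eqF.
rewrite ler_piMr ?mulr_ge0 ?(ltW e0)// ler_pdivrMr// mul1r /m lerDl.
exact: ler01.
Qed.

(* Mean value theorem for [Re (c f(tz))], [c] the unit direction that turns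
   [f z - f 0] into its modulus, against the primitive [- ln (1 - t |z|)]. *)
Lemma bloch_growth (R : realType) (f : R[i] -> R[i]^o) (z : R[i]) :
  analytic_in_disk f -> (bloch_norm f <= 1)%E -> cmod z < 1 ->
  cmod (f z) <= 1 - ln (1 - cmod z).
Proof.
move=> fA fB z1.
have f'le (w : R[i]) : cmod w < 1 -> 
    (cmod (f 0) + cmod (derive1 f w) * (1 - cmod w ^+ 2) <= 1).
  move=> w1; rewrite -lee_fin EFinD; apply: le_trans fB.
  rewrite /bloch_norm leeD2l//; apply: ereal_sup_ubound.
  by exists w.
have f01 : cmod (f 0) <= 1.
  have := f'le 0; rewrite Normc.normc0 expr0n/= subr0 mulr1 => /(_ ltr01).
  by have := cmod_ge0 (derive1 f 0); lra.
(* The bound 1 / (1 - |w|^2) is weakened to 1 / (1 - |w|), whose radial primitive is a single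
   logarithm. *)
have {}f'le w : cmod w < 1 -> cmod (derive1 f w) <= (1 - cmod w)^-1.
  move=> w1; have w0 := cmod_ge0 w.
  rewrite -[_^-1]mul1r ler_pdivlMr ?subr_gt0//.
  have := f'le w w1; have := cmod_ge0 (f 0); have := cmod_ge0 (derive1 f w).
  nra.
set r := cmod z in z1 *; have r0 : 0 <= r := cmod_ge0 z.
have ln0 : ln (1 - r) <= 0 by rewrite ln_le0//; lra.
(* If [f z = f 0] there is no direction to normalise, but the claim follows from
   [cmod (f 0) <= 1]. *)
have [fz0|fz0] := eqVneq (f z - f 0) 0.
  by have -> : f z = f 0 by [apply/eqP; rewrite -subr_eq0 fz0]; lra.
set D := f z - f 0 in fz0.
have D0 : 0 < cmod D by rewrite cmod_gt0.
suff : cmod D <= - ln (1 - r).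
  have -> : f z = D + f 0 by rewrite /D subrK.
  by have := cmodD D (f 0); lra.
pose c : R[i] := ((cmod D)^-1)%:C * D^*%C.
have c1 : cmod c = 1.
  by rewrite Normc.normcM cmod_real cmod_conjc
    ger0_norm ?invr_ge0 ?cmod_ge0// mulVf ?gt_eqF.
pose h (t : R) := complex.Re (c * f (t%:C * z)).
pose h' (t : R) := complex.Re (c * (derive1 f (t%:C * z) * z)).
have tz1 t : 0 <= t <= 1 -> cmod (t%:C * z) = t * r.
  by move=> /andP[t0 _]; rewrite Normc.normcM cmod_real ger0_norm.
have tz2 t : 0 <= t <= 1 -> t * r < 1.
  by nra.
have dh (t : R) : 0 <= t <= 1 ->
    is_derive t 1 (fun t => - ln (1 - t * r) - h t) (r / (1 - t * r) - h' t).
  move=> t01; have tr0 : 0 < 1 - t * r by rewrite subr_gt0 tz2.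
  have dlin : is_derive t 1 (fun t => 1 - t * r) (- r).
    by apply: is_derive_eq; rewrite !add0r scaler0 add0r mul1r /GRing.scale/= mulr1.
  have dln := is_derive1_comp (f := @ln R) (g := fun t => 1 - t * r)
    (is_derive1_ln tr0) dlin.
  have dh : is_derive t 1 h (h' t).
    by apply: is_derive_Re_radial; apply: fA; rewrite /unit_disk/= tz1// tz2.
  by apply: is_derive_eq; rewrite mulrN opprK mulrC.
set G := fun t : R => _ in dh.
have cG : {within `[0, 1], continuous G}.
  apply: continuous_in_subspaceT => t; rewrite inE/= in_itv/= => /dh[dG _].
  by apply: differentiable_continuous; apply/derivable1_diffP.
have dG (t : R) : t \in `]0, 1[ -> is_derive t 1 G (r / (1 - t * r) - h' t).
  by rewrite in_itv/= => /andP[t0 t1]; apply: dh; rewrite !ltW.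
have [t] := MVT ltr01 dG cG; rewrite in_itv/= => /andP[t0 t1].
have t01 : 0 <= t <= 1 by rewrite !ltW.
have h't : h' t <= r / (1 - t * r).
  apply: le_trans (ler_norm _) _; apply: le_trans (ler_Re_cmod _) _.
  rewrite Normc.normcM c1 mul1r Normc.normcM -/r mulrC ler_wpM2l// -tz1//.
  by apply: f'le; rewrite tz1// tz2.
have hD : h 1 - h 0 = cmod D.
  have -> : h 1 - h 0 = complex.Re (c * D).
    rewrite /h mul1r mul0r /D; move: (f z) (f 0) => [? ?] [? ?].
    by case: (c) => ? ? /=; ring.
  rewrite /c -mulrA; have := Re_conjcM D; case: (D^*%C * D) => a b /= ->.
  by rewrite mul0r subr0 expr2 mulKf// gt_eqF.
rewrite /G mul1r mul0r !subr0 ln1 oppr0 sub0r opprK mulr1.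
lra.
Qed.

(** * Upper bound for the extremal constant *)

(* [x <= exp x] at [x = (c / p) * X], raised to the power [p]. *)
Lemma powR_le_expR (R : realType) (c p X : R) : 0 < c -> 0 < p -> 0 <= X ->
  X `^ p <= (p / c) `^ p * expR (c * X).
Proof.
move=> c0 p0 X0; have pc0 : 0 < p / c by rewrite divr_gt0.
have -> : expR (c * X) = expR (c / p * X) `^ p.
  by rewrite -expRM; congr expR; field; rewrite gt_eqF.
rewrite -powRM ?expR_ge0 ?(ltW pc0)//.
have le1 : X <= p / c * expR (c / p * X).
  have := expR_ge1Dx (c / p * X) => h.
  have {}h : c / p * X <= expR (c / p * X) by lra.
  have := ler_wpM2l (ltW pc0) h; apply: le_trans.
  by rewrite le_eqVlt; apply/orP; left; apply/eqP; field; rewrite !gt_eqF.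
by apply: ge0_ler_powR; rewrite ?nnegrE ?(ltW p0)// (le_trans X0 le1).
Qed.

(** The logarithmic growth bound turns exp (c |f(z)|) into at most e^c (1 - |z|)^(-c). Since 1 - |z|
    >= (1 - |z|^2) / 2, this costs a factor 2^c and leaves a power of 1 - |z|^2 that merges with the
    weight. *)
Lemma bloch_integrand_le (R : realType) (alpha c p : R)
    (f : R[i] -> R[i]^o) (z : R[i]) :
  -1 < alpha -> 0 < c -> 0 < p ->
  analytic_in_disk f -> (bloch_norm f <= 1)%E -> unit_disk z ->
  cmod (f z) `^ p * bergman_weight alpha z <=
  (p / c) `^ p * (expR c * 2 `^ c * ((alpha + 1) / pi)) *
    (1 - cmod z ^+ 2) `^ (alpha - c).
Proof.
move=> a1 c0 p0 fA fB z1; have fz := bloch_growth fA fB z1.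
move: z1; rewrite /unit_disk/= => z1.
set r := cmod z in z1 fz *; have r0 : 0 <= r := cmod_ge0 z.
have r1 : 0 < 1 - r by lra.
have r2 : 0 < 1 - r ^+ 2 by nra.
have h1 : cmod (f z) `^ p <= (p / c) `^ p * expR (c * cmod (f z)).
  by apply: powR_le_expR => //; exact: cmod_ge0.
have h2 : expR (c * cmod (f z)) <= expR c * (2 `^ c * (1 - r ^+ 2) `^ (- c)).
  apply: (@le_trans _ _ (expR (c * (1 - ln (1 - r))))).
    by rewrite ler_expR ler_wpM2l// ltW.
  rewrite mulrBr mulr1 expRD ler_wpM2l ?expR_ge0//.
  have -> : expR (- (c * ln (1 - r))) = (1 - r) `^ (- c).
    by rewrite /powR gt_eqF// mulNr.
  apply: (@le_trans _ _ ((2^-1 * (1 - r ^+ 2)) `^ (- c))).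
    apply: le0_ger_powR; [lra|by rewrite mulr_gt0|nra].
  rewrite powRM ?(ltW r2)//.
  by rewrite -powR_inv1// -powRrM mulN1r opprK.
have w0 : 0 <= (1 - r ^+ 2) `^ alpha * ((alpha + 1) / pi).
  by rewrite mulr_ge0 ?powR_ge0 ?divr_ge0 ?pi_ge0//; lra.
have -> : bergman_weight alpha z = (1 - r ^+ 2) `^ alpha * ((alpha + 1) / pi).
  by rewrite /bergman_weight -/r; ring.
apply: (@le_trans _ _ ((p / c) `^ p * (expR c * (2 `^ c * (1 - r ^+ 2) `^ (- c))) *
   ((1 - r ^+ 2) `^ alpha * ((alpha + 1) / pi)))).
  apply: ler_wpM2r => //; apply: (le_trans h1).
  by rewrite ler_wpM2l ?powR_ge0.
rewrite [_ `^ (alpha - c)]powRD ?(gt_eqF r2) ?implybT// le_eqVlt.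
by apply/orP; left; apply/eqP; ring.
Qed.

Lemma unit_disk_pairE (R : realType) :
  [set w : R * R | unit_disk (w.1 +i* w.2)] =
  [set w | w.1 ^+ 2 + w.2 ^+ 2 < 1].
Proof.
apply/funext => w; apply/propext; rewrite /mkset /unit_disk -(sqr_cmod w.1 w.2).
by rewrite expr_lt1// cmod_ge0.
Qed.

Lemma bloch_bergman_const_le (R : realType) (alpha : R) : -1 < alpha ->
  exists2 B : R, 0 < B &
    forall p, 1 <= p -> (bloch_bergman_const alpha p <= (B * p)%:E)%E.
Proof.
(* With [c = alpha + 1 - e] the exponent [alpha - c] is [e - 1]. Here [0 < e <= 1/2] puts it in the
   range of [integral_disk_powR], and [e <= (alpha + 1) / 2] keeps [c] positive. *)
move=> a1; pose e := Num.min (2^-1) ((alpha + 1) / 2).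
have e0 : 0 < e by rewrite lt_min invr_gt0 ltr0n divr_gt0//; lra.
have e1 : e <= 2^-1 by rewrite ge_min lexx.
have e2 : e <= (alpha + 1) / 2 by rewrite ge_min lexx orbT.
pose c := alpha + 1 - e; have c0 : 0 < c by rewrite /c; lra.
have [K K0 HK] := @integral_disk_powR R (e - 1) ltac:(lra) ltac:(lra).
pose M := expR c * 2 `^ c * ((alpha + 1) / pi).
have M0 : 0 < M.
  by rewrite !mulr_gt0 ?expR_gt0 ?powR_gt0 ?invr_gt0 ?pi_gt0//; lra.
have MK0 : 0 <= M * K by rewrite ltW// mulr_gt0.
pose y := Num.max 1 (M * K).
have y1 : 1 <= y by rewrite le_max lexx.
exists (y / c); first by rewrite divr_gt0//; lra.
move=> p p1; have p0 : 0 < p by lra.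
apply: ge_ereal_sup => _ [f [[fA _] fB] <-].
have pc0 : 0 <= p / c by rewrite divr_ge0// ltW.
rewrite /bergman_norm.
apply: (@le_trans _ _ (((p / c) `^ p * (M * K))%:E `^ p^-1)%E); last first.
  rewrite poweR_EFin lee_fin powRM ?powR_ge0//.
  rewrite -powRrM mulfV ?gt_eqF// powRr1//.
  have -> : y / c * p = p / c * y by field; rewrite gt_eqF.
  rewrite ler_wpM2l//.
  apply: (@le_trans _ _ (y `^ p^-1)).
    apply: ge0_ler_powR; rewrite ?nnegrE ?invr_ge0 ?(ltW p0)//; first by lra.
    by rewrite /y le_max lexx orbT.
  by rewrite ler1_powR// invf_le1.
have w0 (w : R * R) :
    0 <= cmod (f (w.1 +i* w.2)) `^ p * bergman_weight alpha (w.1 +i* w.2).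
  rewrite mulr_ge0 ?powR_ge0// /bergman_weight.
  by rewrite mulr_ge0 ?invr_ge0 ?pi_ge0// mulr_ge0 ?powR_ge0//; lra.
apply: gt0_ler_poweR; rewrite ?invr_ge0 ?(ltW p0)//.
- by rewrite in_itv/= leey andbT; apply: integral_ge0 => w wD; rewrite lee_fin.
- by rewrite in_itv/= leey andbT lee_fin mulr_ge0 ?powR_ge0.
have a0 : 0 <= (p / c) `^ p * M by rewrite mulr_ge0 ?powR_ge0// ltW.
rewrite mulrA; apply: (le_trans _ (HK _ a0)); rewrite unit_disk_pairE.
apply: le_integral_patch.
- by move=> w _; rewrite lee_fin.
- by move=> w _; rewrite lee_fin mulr_ge0 ?powR_ge0.
move=> w wD; rewrite patchE mem_set// lee_fin.
rewrite -(sqr_cmod w.1 w.2) (_ : e - 1 = alpha - c); last by rewrite /c; ring.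
apply: bloch_integrand_le => //.
by move: wD; rewrite -unit_disk_pairE.
Qed.

(** * Lacunary polynomials: Bloch norm and size near 1 *)

Lemma cmod_sum (R : realType) (I : Type) (r : seq I) (P : pred I) (F : I -> R[i]) :
  cmod (\sum_(i <- r | P i) F i) <= \sum_(i <- r | P i) cmod (F i).
Proof.
apply: (big_ind2 (fun x y => cmod x <= y)) => //; first by rewrite Normc.normc0.
by move=> x1 x2 y1 y2 h1 h2; apply: (le_trans (cmodD _ _)); exact: lerD.
Qed.

(** Factor out [z - 1]: the cofactor is a geometric sum of [n] terms of modulus at most 1. *)
Lemma cmod_subX1_le (R : realType) (z : R[i]) n : cmod z <= 1 ->
  cmod (z ^+ n - 1) <= n%:R * cmod (z - 1).
Proof.
move=> z1; rewrite subrX1 Normc.normcM mulrC ler_wpM2r ?cmod_ge0//.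
apply: (le_trans (cmod_sum _ _ _)); apply: (@le_trans _ _ (\sum_(i < n) 1)).
  by apply: ler_sum => i _; rewrite cmodX exprn_ile1 ?cmod_ge0.
by rewrite sumr_const card_ord.
Qed.

(** Partial sum of a Hadamard gap series; the factor 1/4 brings the Bloch norm down to at most 1. *)
Definition lacunary (R : realType) (m : nat) (z : R[i]) : R[i]^o :=
  (4%:R^-1)%:C * \sum_(k < m) z ^+ (2 ^ k).

Lemma is_derive_lacunary (R : realType) m (z : R[i]^o) :
  is_derive z (1 : R[i]^o) (@lacunary R m : R[i]^o -> R[i]^o)
    ((4%:R^-1)%:C * \sum_(k < m) (2 ^ k)%:R * z ^+ (2 ^ k).-1).
Proof.
pose g (k : 'I_m) : R[i]^o -> R[i]^o := fun w => w ^+ (2 ^ k).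
have dg k : is_derive z (1 : R[i]^o) (g k) ((2 ^ k)%:R * z ^+ (2 ^ k).-1).
  have := is_deriveX (2 ^ k) (is_derive_id z (1 : R[i]^o)).
  rewrite /GRing.scale/= mulr1; congr (is_derive _ _ _ _).
  by apply/funext => w; rewrite /g exprfctE.
have := is_deriveZ ((4%:R^-1)%:C : R[i]) (is_derive_sum dg).
congr (is_derive _ _ _ _).
by apply/funext => w; rewrite /lacunary /= fct_sumE.
Qed.

(** The right side is kept sharper than 2 so that induction telescopes. With N = 2^m, comparing N
    r^(N-1) with the geometric sum gives (1 - r) N r^(N-1) <= 1 - r^N; multiplied by 2 r^N, this
    bounds the next term by 2 (r^N - r^(2N)). *)
Lemma sum_lacunary_le (R : realFieldType) (r : R) m : 0 <= r -> r <= 1 ->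
  (1 - r) * \sum_(k < m.+1) (2 ^ k)%:R * r ^+ (2 ^ k).-1 <= 2 * (1 - r ^+ (2 ^ m)).
Proof.
move=> r0 r1; elim: m => [|m IH].
  rewrite big_ord1 expn0 expr0 expr1; lra.
rewrite big_ord_recr/= mulrDr; set N := (2 ^ m)%N in IH *.
have N0 : (0 < N)%N by rewrite expn_gt0.
rewrite expnS -/N mul2n -addnn.
have -> : (N + N).-1 = (N + N.-1)%N by case: N N0 {IH} => // n _; rewrite addnS.
have h : (1 - r) * (N%:R * r ^+ N.-1) <= 1 - r ^+ N.
  have -> : 1 - r ^+ N = (1 - r) * \sum_(i < N) r ^+ i.
    by rewrite -[LHS]opprB subrX1 -mulNr opprB.
  rewrite ler_wpM2l ?subr_ge0//.
  have -> : N%:R * r ^+ N.-1 = \sum_(i < N) r ^+ N.-1.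
    by rewrite sumr_const card_ord mulr_natl.
  apply: ler_sum => i _; apply: ler_wiXn2l => //.
  by rewrite -ltnS prednK.
have rN0 : 0 <= r ^+ N by rewrite exprn_ge0.
rewrite natrD !exprD.
move: (\sum_(i < _) _) (r ^+ N) (r ^+ N.-1) rN0 IH h => S x y x0 IH h.
have := ler_wpM2l x0 h.
nra.
Qed.
(** Writing 1 - r^2 = (1 - r)(1 + r), the first factor times the derivative sum is at most 2 and the
    second is at most 2; the coefficient 1/4 cancels their product. *)
Lemma bloch_seminorm_lacunary (R : realType) m :
  (bloch_seminorm (@lacunary R m.+1) <= 1)%E.
Proof.
apply: ge_ereal_sup => _ [z z1 <-]; rewrite lee_fin.
move: z1; rewrite /unit_disk/=.
have -> : derive1 (@lacunary R m.+1) z =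
    (4%:R^-1)%:C * \sum_(k < m.+1) (2 ^ k)%:R * z ^+ (2 ^ k).-1.
  by rewrite derive1E; have [_] := is_derive_lacunary m.+1 z.
have r0 := cmod_ge0 z; set r := cmod z in r0 * => r1.
have le : cmod (\sum_(k < m.+1) (2 ^ k)%:R * z ^+ (2 ^ k).-1) <=
    \sum_(k < m.+1) (2 ^ k)%:R * r ^+ (2 ^ k).-1.
  apply: (le_trans (cmod_sum _ _ _)); apply: ler_sum => k _.
  by rewrite Normc.normcM cmodX cmod_nat.
have := sum_lacunary_le m r0 (ltW r1).
rewrite Normc.normcM cmod_real ger0_norm ?invr_ge0//.
have rm : 0 <= r ^+ (2 ^ m) by rewrite exprn_ge0.
move: le rm; set a := cmod _; set b := \sum_(k < m.+1) _ => ab x0 h.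
have h1 : (1 - r) * a <= 2.
  have := ler_wpM2l _ ab => /(_ (1 - r)); rewrite subr_ge0 => /(_ (ltW r1)); lra.
have {}h1 := ler_wpM2r (addr_ge0 ler01 r0) h1.
nra.
Qed.

Lemma lacunary_bloch (R : realType) m :
  bloch_space (@lacunary R m.+1) /\ (bloch_norm (@lacunary R m.+1) <= 1)%E.
Proof.
have le1 := bloch_seminorm_lacunary R m; split; first split.
- by move=> z _; have [] := is_derive_lacunary m.+1 z.
- exact: le_lt_trans le1 (ltry _).
rewrite /bloch_norm /lacunary big1 ?mulr0 ?Normc.normc0 ?add0e// => k _.
by rewrite expr0n expn_eq0.
Qed.

(** Each of the [m] powers differs from 1 by at most 3/8, so their sum has modulus at least 5m/8,
    and a quarter of this exceeds or equals m/8. *)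
Lemma lacunary_ge (R : realType) m (z : R[i]) : cmod z <= 1 ->
  cmod (z - 1) <= 3 * 2 ^- m.+2 -> m%:R / 8 <= cmod (lacunary m z).
Proof.
move=> z1 zd; rewrite /lacunary Normc.normcM cmod_real ger0_norm ?invr_ge0//.
set S := \sum_(k < m) _.
suff : cmod (m%:R - S) <= m%:R * (3 / 8).
  have : (m%:R : R) <= cmod (m%:R - S) + cmod S.
    by rewrite -[leLHS]cmod_nat -{1}(subrK S m%:R) cmodD.
  have := ler0n R m; lra.
have -> : m%:R - S = \sum_(k < m) (1 - z ^+ (2 ^ k)).
  by rewrite sumrB sumr_const card_ord.
apply: (le_trans (cmod_sum _ _ _)).
apply: (@le_trans _ _ (\sum_(k < m) (3 / 8))); last first.
  by rewrite sumr_const card_ord [leRHS]mulr_natl.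
apply: ler_sum => k _; rewrite -cmodN opprB.
apply: (le_trans (cmod_subX1_le _ z1)).
apply: (@le_trans _ _ ((2 ^ m.-1)%:R * (3 * 2 ^- m.+2))).
  apply: ler_pM => //; first exact: cmod_ge0.
  by rewrite ler_nat leq_exp2l// -ltnS prednK// (leq_ltn_trans _ (ltn_ord k)).
(* This fails at [m = 0], a case excluded by the index [k < m]. The powers of two then cancel to
   2^-3, giving 3/8. *)
have -> : m.+2 = (m.-1 + 3)%N by case: m {S zd} k => [[]//|m' k]; rewrite /= addn3.
rewrite exprD invfM natrX.
have : (2 : R) ^+ m.-1 * 2 ^- m.-1 = 1 by rewrite mulfV// expf_neq0.
nra.
Qed.

(** * Lower bound for the extremal constant *)

(** On this square of side [d] the distance to 1 is at most 2d + d = 3d, as [lacunary_ge] demands,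
    while |z|^2 <= (1 - d)^2 + d^2 <= 1 - d keeps the weight under control. *)
Lemma lacunary_integrand_ge (R : realType) (alpha p d : R) m (x y : R) :
  -1 < alpha -> 0 <= p -> d = 2 ^- m.+2 ->
  1 - 2 * d <= x <= 1 - d -> 0 <= y <= d ->
  unit_disk (x +i* y) /\
  (m%:R / 8) `^ p * ((alpha + 1) / pi * d `^ `|alpha|) <=
  cmod (lacunary m (x +i* y)) `^ p * bergman_weight alpha (x +i* y).
Proof.
move=> a1 p0 dE /andP[x1 x2] /andP[y1 y2].
have d0 : 0 < d by rewrite dE invr_gt0 exprn_gt0.
have d4 : d <= 4^-1.
  rewrite dE lef_pV2 ?posrE ?exprn_gt0//.
  rewrite -[4]/(4%:R) (natrX _ 2 2); apply: ler_weXn2l => //; lra.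
have xy : cmod (x +i* y) ^+ 2 <= 1 - d by rewrite sqr_cmod; nra.
have z1 : cmod (x +i* y) < 1.
  by rewrite -(@expr_lt1 _ 2)// ?cmod_ge0//; lra.
split => //; apply: ler_pM.
- exact: powR_ge0.
- by rewrite mulr_ge0 ?powR_ge0// divr_ge0 ?pi_ge0//; lra.
- apply: ge0_ler_powR => //; rewrite ?nnegrE ?cmod_ge0//.
  apply: lacunary_ge; first exact: ltW.
  rewrite -dE; have -> : (x +i* y) - 1 = (x - 1)%:C + (0 +i* y).
    by apply/eqP; rewrite eq_complex/= addr0 add0r subr0 !eqxx.
  apply: (le_trans (cmodD _ _)); rewrite cmod_real.
  have -> : cmod (0 +i* y) = y.
    by rewrite /= expr0n/= add0r sqrtr_sqr ger0_norm.
  rewrite ler0_norm; lra.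
rewrite /bergman_weight; set t := 1 - cmod _ ^+ 2.
have t1 : d <= t by rewrite /t; lra.
have t2 : t <= 1 by rewrite /t; have := sqr_ge0 (cmod (x +i* y)); lra.
(* The absolute value covers both signs: for [alpha >= 0] use [d <= t]; for [alpha < 0] the number 1
   separates the two sides, as [d] and [t] are at most 1. *)
have dt : d `^ `|alpha| <= t `^ alpha.
  have [a0|a0] := leP 0 alpha.
    by rewrite ger0_norm//; apply: ge0_ler_powR; rewrite ?nnegrE//; lra.
  apply: (@le_trans _ _ 1).
    by rewrite -(powRr0 d) ger_powR// d0; lra.
  have := @le0_ger_powR _ alpha t 1 (ltW a0); rewrite powR1; apply; lra.
have -> : (alpha + 1) * t `^ alpha / pi = (alpha + 1) / pi * t `^ alpha by ring.
by apply: ler_wpM2l => //; rewrite divr_ge0 ?pi_ge0//; lra.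
Qed.

(** Only the square is kept from the disk; its area [d ^+ 2] adds 2 to the exponent [|alpha|] coming
    from the weight. *)
Lemma bergman_norm_lacunary_ge (R : realType) (alpha p d : R) m :
  -1 < alpha -> 0 < p -> d = 2 ^- m.+2 ->
  ((m%:R / 8 * ((alpha + 1) / pi) `^ p^-1 *
    d `^ ((`|alpha| + 2) / p))%:E <= bergman_norm alpha p (@lacunary R m))%E.
Proof.
move=> a1 p0 dE; set k := (alpha + 1) / pi.
have d0 : 0 < d by rewrite dE invr_gt0 exprn_gt0.
have k0 : 0 <= k by rewrite divr_ge0 ?pi_ge0//; lra.
pose a := (m%:R / 8) `^ p * (k * d `^ `|alpha|).
have kd0 : 0 <= k * d `^ `|alpha| by rewrite (mulr_ge0 k0) ?powR_ge0.
have a0 : 0 <= a by rewrite mulr_ge0 ?powR_ge0.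
have -> : m%:R / 8 * k `^ p^-1 * d `^ ((`|alpha| + 2) / p) = (a * d ^+ 2) `^ p^-1.
  have -> : a * d ^+ 2 = (m%:R / 8) `^ p * (k * d `^ (`|alpha| + 2)).
    rewrite powRD ?(gt_eqF d0) ?implybT// (powR_mulrn 2 (ltW d0)) /a; ring.
  rewrite (powRM _ (powR_ge0 _ _) (mulr_ge0 k0 (powR_ge0 _ _))).
  rewrite (powRM _ k0 (powR_ge0 _ _)) -!powRrM mulfV ?gt_eqF// powRr1 ?mulrA//.
rewrite -poweR_EFin.
pose S : set (R * R) := `[1 - 2 * d, 1 - d] `*` `[0, d].
have mS : (lebesgue_measure \x lebesgue_measure)%E S = (d ^+ 2)%:E.
  rewrite product_measure1E; [|exact: measurable_itv..].
  rewrite /= !lebesgue_measure_itv/= !lte_fin d0 ifT; last lra.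
  by rewrite -!EFinB -EFinM; congr (_%:E); ring.
have w0 (w : R * R) :
    0 <= cmod (lacunary m (w.1 +i* w.2)) `^ p * bergman_weight alpha (w.1 +i* w.2).
  rewrite mulr_ge0 ?powR_ge0// /bergman_weight.
  by rewrite mulr_ge0 ?invr_ge0 ?pi_ge0// mulr_ge0 ?powR_ge0//; lra.
apply: gt0_ler_poweR; rewrite ?invr_ge0 ?(ltW p0)//.
- by rewrite in_itv/= leey andbT lee_fin mulr_ge0// sqr_ge0.
- by rewrite in_itv/= leey andbT; apply: integral_ge0 => w wD; rewrite lee_fin.
rewrite EFinM -mS -integral_cst; last by apply: measurableX; exact: measurable_itv.
apply: le_integral_patch => [w _|w _|[x y] [/=]]; rewrite ?lee_fin//.
rewrite !in_itv/= => hx hy.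
have [zD] := lacunary_integrand_ge a1 (ltW p0) dE hx hy.
by rewrite patchE mem_set// lee_fin.
Qed.

Lemma bloch_bergman_const_ge (R : realType) (alpha : R) : -1 < alpha ->
  exists2 A : R, 0 < A &
    forall p, 1 <= p -> ((A * p)%:E <= bloch_bergman_const alpha p)%E.
Proof.
move=> a1; pose k := (alpha + 1) / pi.
have k0 : 0 < k by rewrite divr_gt0 ?pi_gt0//; lra.
(* Capping at 1 gives [y <= y]^ p^-1 <= k [^ p^-1] uniformly in [p >= 1]. *)
pose y := Num.min 1 k.
have y0 : 0 < y by rewrite lt_min k0 ltr01.
have y1 : y <= 1 by rewrite ge_min lexx.
pose q := 4 * (`|alpha| + 2).
exists (y * 2 `^ (- q) / 8).
  by rewrite divr_gt0// mulr_gt0// powR_gt0.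
move=> p p1; have p0 : 0 < p by lra.
pose m := Num.truncn p.
have [mp pm] : m%:R <= p /\ p < m.+1%:R.
  by have /andP[] := Num.Theory.truncn_itv (ltW p0).
apply: (@le_trans _ _ (bergman_norm alpha p (@lacunary R m.+1))); last first.
  by apply: ereal_sup_ubound; exists (@lacunary R m.+1) => //; exact: lacunary_bloch.
apply: le_trans (bergman_norm_lacunary_ge a1 p0 erefl); rewrite lee_fin -/k.
have ky : y <= k `^ p^-1.
  apply: (@le_trans _ _ (y `^ p^-1)).
    by apply: ger1_powR; rewrite ?y0// invf_le1.
  apply: ge0_ler_powR; rewrite ?nnegrE ?invr_ge0 ?(ltW p0) ?(ltW y0) ?(ltW k0)//.
  by rewrite /y ge_min lexx orbT.
have dq : 2 `^ (- q) <= (2 ^- m.+3) `^ ((`|alpha| + 2) / p).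
  rewrite -powR_invn// -powRrM; apply: ler_powR; first lra.
  rewrite mulNr lerN2 /q mulrA ler_pdivrMr// mulrAC.
  rewrite ler_wpM2r ?addr_ge0//.
  rewrite -addn3 natrD; lra.
have -> : y * 2 `^ (- q) / 8 * p = p / 8 * y * 2 `^ (- q) by ring.
apply: ler_pM; rewrite ?powR_ge0//.
- by rewrite mulr_ge0 ?(ltW y0)//; lra.
- by apply: ler_pM; rewrite ?(ltW y0)//; lra.
Qed.

Theorem theorem3p2 (R : realType) (alpha : R) (halpha : (-1 < alpha)%R) :
  exists A B : R, (0 < A)%R /\ (0 < B)%R /\
    forall p : R, (1 <= p)%R ->
      ((A * p)%:E <= bloch_bergman_const alpha p)%E /\
      (bloch_bergman_const alpha p <= (B * p)%:E)%E.
Proof.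
have [A A0 HA] := bloch_bergman_const_ge halpha.
have [B B0 HB] := bloch_bergman_const_le halpha.
by exists A, B; split=> //; split=> // p p1; split; [exact: HA|exact: HB].
Qed.
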